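(* Let $R$ be a commutative ring and $q\in R$ such that $R$ is $q$-torsion free and $qR$ is a prime ideal. Then for every $d\geq 1$ the group $A_d(R,q)$ is solvable.
   Context: For a commutative ring $B$, $\mathrm{Aut}(\mathbb{A}^1_B)$ denotes the group of polynomials $f\in B[T]$ invertible under composition, with group law composition. $A_d(R,q)$ is the subgroup of $\mathrm{Aut}(\mathbb{A}^1_{R/q^d})$ consisting of invertible polynomials of the form $a_0+a_1T+qa_2T^2+q^2a_3T^3+\cdots+q^{d-1}a_dT^d \bmod q^d$ with $a_i\in R$. *)

(* Defs.v *)
From HB Require Import structures.
From mathcomp Require Import all_boot all_algebra generic_quotient ring_quotient.
From mathcomp Require Import boolp classical_sets zify.

Set Implicit Arguments.
Unset Strict Implicit.
Unset Printing Implicit Defensive.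

Import GRing.Theory.
Local Open Scope ring_scope.
Local Open Scope quotient_scope.
Local Open Scope classical_set_scope.

Section PrincipalIdeal.
Variable R : comNzRingType.

Definition principal (x : R) : {pred R} := fun y => `[< exists z, y = x * z >].

Lemma principalP (x y : R) : reflect (exists z, y = x * z) (y \in principal x).
Proof. exact: asboolP. Qed.

Definition torsion_free (x : R) : Prop := forall y : R, x * y = 0 -> y = 0.

(* In ring_quotient, idealr_closed includes properness (1 is not in the ideal) *)
(* and prime_idealr_closed is only the multiplicative clause.                  *)
Definition prime_ideal (S : {pred R}) : Prop :=
  idealr_closed S /\ prime_idealr_closed S.

Lemma principal_idealr_closed (x : R) :
  1 \notin principal x -> idealr_closed (principal x).
Proof.
move=> x1; split=> //; first by apply/principalP; exists 0; rewrite mulr0.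
move=> a u v /principalP[y ->] /principalP[z ->]; apply/principalP.
by exists (a * y + z); rewrite mulrDr mulrCA.
Qed.

Lemma principal_exp_idealr_closed (q : R) (d : nat) :
  prime_ideal (principal q) -> (0 < d)%N -> idealr_closed (principal (q ^+ d)).
Proof.
move=> [[_ q1 _] _] d0; apply: principal_idealr_closed; apply: contra q1.
move=> /principalP[z e]; apply/principalP; exists (q ^+ d.-1 * z).
by rewrite mulrA -exprS prednK.
Qed.

End PrincipalIdeal.

(* The quotient R/xR. The proof argument is needed because {poly _} requires *)
(* a nonzero coefficient ring.                                               *)
Section PrincipalQuotient.
Variables (R : comNzRingType) (x : R) (xI : idealr_closed (principal x)).

Definition principal_idealr : idealr R :=
  HB.pack (principal x) (isIdealr.Build R (principal x) xI).

Definition quot_ring : comNzRingType := {ideal_quot principal_idealr}.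

Definition quot_proj : {rmorphism R -> quot_ring} :=
  \pi_{ideal_quot principal_idealr}.

Lemma quot_proj_surj (y : quot_ring) : exists z, y = quot_proj z.
Proof. by exists (repr y); rewrite /quot_proj /= reprK. Qed.

Lemma quot_proj_eq0 (y : R) : quot_proj y = 0 <-> exists z, y = x * z.
Proof.
rewrite -(rmorph0 quot_proj); split=> [/eqP|].
  by rewrite -Quotient.idealrBE subr0 => /principalP.
move=> h; apply/eqP; rewrite -Quotient.idealrBE subr0; exact/principalP.
Qed.

End PrincipalQuotient.

Section AutA1.
Variable B : comNzRingType.

Definition comp_invertible (f : {poly B}) : bool :=
  `[< exists g : {poly B}, f \Po g = 'X /\ g \Po f = 'X >].

Record autA1 := AutA1 {autA1_val :> {poly B}; _ : comp_invertible autA1_val}.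

HB.instance Definition _ := [isSub for autA1_val].
HB.instance Definition _ := [Choice of autA1 by <:].

Lemma autA1P (f : autA1) : exists g : {poly B}, f \Po g = 'X /\ g \Po f = 'X.
Proof. by case: f => f /= /asboolP. Qed.

Lemma comp_invertible1 : comp_invertible 'X.
Proof. by apply/asboolP; exists 'X; rewrite comp_polyX. Qed.

Definition autA1_one : autA1 := AutA1 comp_invertible1.

Lemma comp_invertibleM (f g : autA1) : comp_invertible (f \Po g).
Proof.
have [[f' [ff' f'f]] [g' [gg' g'g]]] := (autA1P f, autA1P g).
apply/asboolP; exists (g' \Po f'); split.
  by rewrite comp_polyA -(comp_polyA f) gg' comp_polyXr.
by rewrite comp_polyA -(comp_polyA g') f'f comp_polyXr.
Qed.

(* The group law is (f * g)(T) = f(g(T)). *)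
Definition autA1_mul (f g : autA1) : autA1 := AutA1 (comp_invertibleM f g).

Lemma autA1_inv_subproof (f : autA1) : comp_invertible (sval (cid (autA1P f))).
Proof. by case: cid => g [fg gf]; apply/asboolP; exists f. Qed.

Definition autA1_inv (f : autA1) : autA1 := AutA1 (autA1_inv_subproof f).

Lemma autA1_mulA : associative autA1_mul.
Proof. by move=> f g h; apply/val_inj; rewrite /= comp_polyA. Qed.

Lemma autA1_mul1 : left_id autA1_one autA1_mul.
Proof. by move=> f; apply/val_inj; rewrite /= comp_polyX. Qed.

Lemma autA1_mulr1 : right_id autA1_one autA1_mul.
Proof. by move=> f; apply/val_inj; rewrite /= comp_polyXr. Qed.

Lemma autA1_mulV : left_inverse autA1_one autA1_inv autA1_mul.
Proof. by move=> f; apply/val_inj => /=; case: cid => g []. Qed.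

Lemma autA1_mulrV : right_inverse autA1_one autA1_inv autA1_mul.
Proof. by move=> f; apply/val_inj => /=; case: cid => g []. Qed.

HB.instance Definition _ := isGroup.Build autA1
  autA1_mulA autA1_mul1 autA1_mulr1 autA1_mulV autA1_mulrV.

End AutA1.

(* Polynomials whose coefficient of T^i lies in c^(i-1)B for i >= 1, with c *)
(* nilpotent. These facts show that A_d(R, q) is a subgroup.                *)
Section Filtered.
Variables (B : comNzRingType) (c : B) (d : nat).
Hypothesis c_nilp : c ^+ d = 0.
Implicit Types (p r f g : {poly B}).

Let dvd (x y : B) := exists b, y = x * b.

Let dvd0 x : dvd x 0. Proof. by exists 0; rewrite mulr0. Qed.

Let dvdD x y z : dvd x y -> dvd x z -> dvd x (y + z).
Proof. by move=> [a ->] [b ->]; exists (a + b); rewrite mulrDr. Qed.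

Let dvdMl a x y : dvd x y -> dvd x (a * y).
Proof. by move=> [b ->]; exists (a * b); rewrite mulrCA. Qed.

Definition filtered p := forall i, dvd (c ^+ i.-1) p`_i.

Lemma filteredZ a p : filtered p -> filtered (a *: p).
Proof. by move=> Fp i; rewrite coefZ; apply: dvdMl. Qed.

Lemma filteredD p r : filtered p -> filtered r -> filtered (p + r).
Proof. by move=> Fp Fr i; rewrite coefD; apply: dvdD. Qed.

Lemma filteredC a : filtered a%:P.
Proof.
by move=> [|i]; rewrite coefC //=; exists a; rewrite expr0 mul1r.
Qed.

Lemma filteredX : filtered 'X.
Proof.
move=> [|[|i]]; rewrite coefX //=; try exact: dvd0.
by exists 1; rewrite expr0 mul1r.
Qed.

Lemma filteredM p r : filtered p -> filtered r -> filtered (c *: (p * r)).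
Proof.
move=> Fp Fr i; rewrite coefZ coefM mulr_sumr.
apply: (big_ind (dvd _)) => [||j _]; [exact: dvd0 | exact: dvdD|].
have [[a ->] [b ->]] := (Fp j, Fr (i - j)%N).
have -> : c * (c ^+ j.-1 * a * (c ^+ (i - j).-1 * b)) =
          c ^+ (1 + j.-1 + (i - j).-1) * (a * b).
  by rewrite !exprD expr1 -!mulrA; congr (_ * (_ * _)); rewrite mulrCA.
have le_i : (i.-1 <= 1 + j.-1 + (i - j).-1)%N by lia.
exists (c ^+ ((1 + j.-1 + (i - j).-1) - i.-1) * (a * b)).
by rewrite [RHS]mulrA -exprD subnKC.
Qed.

Lemma filtered_exp n g : filtered g -> filtered (c ^+ n.-1 *: g ^+ n).
Proof.
move=> Fg; elim: n => [|n IHn].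
  by rewrite !expr0 scale1r -polyC1; exact: filteredC.
case: n IHn => [_|n IHn]; first by rewrite expr0 scale1r expr1.
rewrite /= exprS -scalerA exprS scalerAr.
exact: filteredM.
Qed.

Lemma filtered_sum (I : Type) (s : seq I) (P : pred I) (F : I -> {poly B}) :
  (forall i, P i -> filtered (F i)) -> filtered (\sum_(i <- s | P i) F i).
Proof.
move=> FF; apply: big_ind => //; last exact: filteredD.
by rewrite -polyC0; exact: filteredC.
Qed.

Lemma filtered_comp f g : filtered f -> filtered g -> filtered (f \Po g).
Proof.
move=> Ff Fg; rewrite comp_polyE; apply: filtered_sum => i _.
have [b ->] := Ff i; rewrite mulrC -scalerA.
by apply: filteredZ; apply: filtered_exp.
Qed.

Let near k p := exists s h, filtered s /\ p = s + c ^+ k *: h.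

Let nearD k p r : near k p -> near k r -> near k (p + r).
Proof.
move=> [s [h [Fs ->]]] [s' [h' [Fs' ->]]]; exists (s + s'), (h + h').
by split; [exact: filteredD | rewrite scalerDr addrACA].
Qed.

Let nearZ k a p : near k p -> near k (a *: p).
Proof.
move=> [s [h [Fs ->]]]; exists (a *: s), (a *: h).
by split; [exact: filteredZ | rewrite scalerDr !scalerA mulrC].
Qed.

Let filtered_near k p : filtered p -> near k p.
Proof. by move=> Fp; exists p, 0; rewrite scaler0 addr0. Qed.

Lemma filtered_lin_unit f g :
  filtered f -> f \Po g = 'X -> exists u, u * f`_1 = 1.
Proof.
move=> Ff fg.
have [h f'E] : exists h, f^`() = (f`_1)%:P + c *: h.
  pose b i := sval (cid (Ff i)).
  exists (\poly_(i < size f) ((c ^+ i.-1 * b i.+1) *+ i.+1 *+ (i != 0)%N)).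
  apply/polyP=> i; rewrite coef_deriv coefD coefC coefZ coef_poly.
  case: i => [|i]; first by rewrite /= mulr0n mulr1n if_same mulr0 addr0.
  rewrite /= add0r mulr1n -mulrnAr; case: ltnP => [lt_i|le_i].
    by rewrite {1}(svalP (cid (Ff i.+2))) -/(b i.+2) /= exprS -mulrA !mulrnAr.
  by rewrite nth_default ?mul0rn ?mulr0 // (leq_trans le_i).
have := congr1 (fun p : {poly B} => p^`().[0]) fg.
rewrite /= deriv_comp derivX f'E comp_polyD comp_polyC comp_polyZ !hornerE.
set y := g^`().[0]; set z := (h \Po g).[0] => e1.
pose w := c * z * y.
have e2 : f`_1 * y = 1 - w by rewrite -e1 /w mulrDl addrK.
exists (y * \sum_(i < d) w ^+ i); rewrite mulrC mulrA e2.
have := subrX1 w d; rewrite /w exprMn exprMn c_nilp !mul0r sub0r -/w => e3.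
by rewrite -[1 - w]opprB mulNr -e3 opprK.
Qed.

Lemma filtered_inv f g : filtered f -> f \Po g = 'X -> filtered g.
Proof.
move=> Ff fg; have [u uf1] := filtered_lin_unit Ff fg.
suff /(_ d) [s [h [Fs ->]]] : forall k, near k g.
  by rewrite c_nilp scale0r addr0.
elim=> [|k [s [h [Fs gE]]]].
  exists 0, g; rewrite expr0 scale1r add0r; split=> //.
  by rewrite -polyC0; exact: filteredC.
have gE' : g = u *: ('X - ((f - f`_1 *: 'X) \Po g)).
  rewrite comp_polyB fg comp_polyZ comp_polyX opprB addrCA subrr addr0.
  by rewrite scalerA uf1 scale1r.
rewrite gE'; apply: nearZ; apply: nearD; first exact: filtered_near filteredX.
rewrite -scaleN1r; apply: nearZ; rewrite comp_polyE.
apply: (big_ind (near k.+1)) => [||i _].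
- by apply: filtered_near; rewrite -polyC0; exact: filteredC.
- exact: nearD.
rewrite coefB coefZ coefX; case: (nat_of_ord i) => [|[|n]].
- by apply: filtered_near; rewrite expr0 alg_polyC; exact: filteredC.
- rewrite mulr1 subrr scale0r; apply: filtered_near.
  by rewrite -polyC0; exact: filteredC.
rewrite mulr0 subr0; have [b ->] := Ff n.+2; rewrite mulrC -scalerA; apply: nearZ.
exists (c ^+ n.+1 *: s ^+ n.+2).
exists (c ^+ n *: (h * \sum_(i < n.+2) g ^+ (n.+1 - i) * s ^+ i)).
split; first exact: (filtered_exp n.+2 Fs).
rewrite [RHS]addrC; apply: (canRL (subrK _)); rewrite -scalerBr subrXX.
have -> : g - s = c ^+ k *: h by rewrite gE addrAC subrr add0r.
by rewrite -scalerAl !scalerA; congr (_ *: _); rewrite -!exprD; congr (_ ^+ _); lia.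
Qed.

End Filtered.

Section Ad.
Variables (R : comNzRingType) (q : R) (d : nat).
Variable qdI : idealr_closed (principal (q ^+ d)).

(* A_d(R, q) as a predicate on Aut(A^1_{R/q^d}); truncated predecessor makes *)
(* the exponent of q equal to 0 for both i = 0 and i = 1.                    *)
Definition Ad_pred : {pred autA1 (quot_ring qdI)} := fun f =>
  `[< exists a : nat -> R,
      val f = map_poly (quot_proj qdI) (\poly_(i < d.+1) (q ^+ i.-1 * a i)) >].

Lemma quot_proj_nilp : quot_proj qdI q ^+ d = 0.
Proof. by rewrite -rmorphXn; apply/quot_proj_eq0; exists 1; rewrite mulr1. Qed.

Lemma Ad_predP (f : autA1 (quot_ring qdI)) :
  f \in Ad_pred <-> filtered (quot_proj qdI q) (val f).
Proof.
split=> [/asboolP[a ->] i|Ff].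
  rewrite coef_map coef_poly; case: ifP => _.
    by exists (quot_proj qdI (a i)); rewrite /= rmorphM rmorphXn.
  by exists 0; rewrite /= rmorph0 mulr0.
have /choice[a aE] : forall i, exists x : R,
    (val f)`_i = quot_proj qdI (q ^+ i.-1 * x).
  move=> i; have [b ->] := Ff i; have [x ->] := quot_proj_surj b.
  by exists x; rewrite rmorphM rmorphXn.
apply/asboolP; exists a; apply/polyP=> i; rewrite coef_map coef_poly /=.
case: ltnP => [_|lt_di]; rewrite ?rmorph0 aE // rmorphM rmorphXn.
have -> : i.-1 = (d + (i.-1 - d))%N by lia.
by rewrite exprD quot_proj_nilp !mul0r.
Qed.

Lemma Ad_pred1 : 1%g \in Ad_pred.
Proof. by apply/Ad_predP; exact: filteredX. Qed.

Lemma Ad_predM : mulg_closed Ad_pred.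
Proof.
move=> f g /Ad_predP Ff /Ad_predP Fg; apply/Ad_predP.
exact: filtered_comp Ff Fg.
Qed.

Lemma Ad_predV : invg_closed Ad_pred.
Proof.
move=> f /Ad_predP Ff; apply/Ad_predP.
apply: (filtered_inv quot_proj_nilp Ff).
by have /(congr1 val) := autA1_mulrV f.
Qed.

HB.instance Definition _ := isMulClosed.Build _ Ad_pred Ad_predM.
HB.instance Definition _ := isMul1Closed.Build _ Ad_pred Ad_pred1.
HB.instance Definition _ := isInvClosed.Build _ Ad_pred Ad_predV.

Definition Ad : groupClosed (autA1 (quot_ring qdI)) := Ad_pred.

End Ad.

Section Solvable.
Variable G : groupType.

Definition subgroup_gen (S : set G) : set G :=
  smallest (fun H : set G => group_closed (mem H)) S.

Definition derived (H : set G) : set G :=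
  subgroup_gen [set z | exists x y, [/\ H x, H y & z = commg x y]].

Definition solvable_subgroup (H : groupClosed G) : Prop :=
  exists n : nat, iter n derived [set x | x \in H] = [set 1%g].

End Solvable.

(* Main.v *)
Require Import Defs.
From mathcomp Require Import all_boot all_algebra ring_quotient.
From mathcomp Require Import boolp classical_sets ring.
Import GRing.Theory.
Local Open Scope ring_scope.

Set Implicit Arguments.
Unset Strict Implicit.

(** Let c be the image of q in R/q^d, so that c^d = 0. Modulo c every element
    of A_d(R, q) is affine, hence a commutator is a translation modulo c, and a
    commutator of two such elements is the identity modulo c. If f = T + c^k h
    and g = T + c^k h' with k >= 1, then fg and gf both agree with
    T + c^k (h + h') modulo c^(k+1), so the commutator of f and g is the
    identity modulo c^(k+1). Hence the derived series reaches the identity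
    after d + 1 steps. *)

(** * Bounding the derived series by a descending chain *)

Section DerivedSeries.
Variable G : groupType.
Implicit Types (H : set G) (N : nat -> set G).

Lemma subgroup_gen_min (S H : set G) :
  group_closed (mem H) -> (S `<=` H)%classic -> (subgroup_gen S `<=` H)%classic.
Proof. by move=> gH SH x; apply. Qed.

Lemma subgroup_gen1 (S : set G) : subgroup_gen S 1%g.
Proof. by move=> H [[H1 _] _]; exact: set_mem H1. Qed.

Lemma iter_derived_sub H N :
    (H `<=` N 0%N)%classic ->
    (forall k, group_closed (mem (N k.+1))) ->
    (forall k x y, N k x -> N k y -> N k.+1 (commg x y)) ->
  forall n, (iter n (@derived G) H `<=` N n)%classic.
Proof.
move=> HN gN cN; elim=> [//|n IHn]; apply: subgroup_gen_min => // z.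
by move=> [x [y [/IHn Nx /IHn Ny ->]]]; exact: cN.
Qed.

Lemma solvable_of_series (H : groupClosed G) N m :
    ([set x | x \in H] `<=` N 0%N)%classic ->
    (forall k, group_closed (mem (N k.+1))) ->
    (forall k x y, N k x -> N k y -> N k.+1 (commg x y)) ->
    (N m `<=` [set 1%g])%classic ->
  solvable_subgroup H.
Proof.
move=> HN gN cN N1; exists m; apply/seteqP; split=> [x|_ ->].
  by move=> /(iter_derived_sub HN gN cN) /N1.
(* For the reverse inclusion, the identity lies in [H] itself when [m = 0] and in any generated
   subgroup otherwise. *)
by case: m {N1} => [|m] /=; [exact: gpred1 | exact: subgroup_gen1].
Qed.

End DerivedSeries.

(** * Congruence of polynomials modulo a scalar *)

Section PolynomialCongruence.
Variable B : comNzRingType.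
Implicit Types (x y : B) (p r s : {poly B}).

Definition poly_eqmod x p r := exists h, p = r + x *: h.

Lemma poly_eqmod_refl x p : poly_eqmod x p p.
Proof. by exists 0; rewrite scaler0 addr0. Qed.

Lemma poly_eqmod_sym x p r : poly_eqmod x p r -> poly_eqmod x r p.
Proof. by move=> [h ->]; exists (- h); rewrite scalerN addrK. Qed.

Lemma poly_eqmod_trans x p r s :
  poly_eqmod x p r -> poly_eqmod x r s -> poly_eqmod x p s.
Proof. by move=> [h ->] [k ->]; exists (k + h); rewrite scalerDr addrA. Qed.

Lemma poly_eqmodD x p p' r r' :
  poly_eqmod x p p' -> poly_eqmod x r r' -> poly_eqmod x (p + r) (p' + r').
Proof. by move=> [h ->] [k ->]; exists (h + k); rewrite scalerDr addrACA. Qed.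

Lemma poly_eqmodM x p p' r r' :
  poly_eqmod x p p' -> poly_eqmod x r r' -> poly_eqmod x (p * r) (p' * r').
Proof.
move=> [h ->] [k ->]; exists (h * r' + (p' + x *: h) * k).
by rewrite mulrDr -scalerAr mulrDl -scalerAl scalerDr addrA.
Qed.

Lemma poly_eqmod_scale x y p r :
  poly_eqmod y p r -> poly_eqmod (x * y) (x *: p) (x *: r).
Proof. by move=> [h ->]; exists h; rewrite scalerDr scalerA. Qed.

Lemma poly_eqmod_dvd x y p r : poly_eqmod (x * y) p r -> poly_eqmod x p r.
Proof. by move=> [h ->]; exists (y *: h); rewrite scalerA. Qed.

Lemma poly_eqmod_comp x p p' r r' :
  poly_eqmod x p p' -> poly_eqmod x r r' -> poly_eqmod x (p \Po r) (p' \Po r').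
Proof.
move=> [h ->] rr'; rewrite comp_polyD comp_polyZ.
apply: (@poly_eqmod_trans _ _ (p' \Po r)); first by exists (h \Po r).
(* The outer polynomial is now fixed; Horner induction on it replaces the inner [r] by [r']. *)
elim/poly_ind: p' => [|s a IHs]; first by rewrite !comp_poly0; exact: poly_eqmod_refl.
rewrite !comp_polyD !comp_polyM !comp_polyX !comp_polyC.
by apply: poly_eqmodD (poly_eqmod_refl _ _); exact: poly_eqmodM.
Qed.

(** The coefficient of degree [i.+2] is a multiple of [x ^+ i.+1], hence of [x]. *)
Lemma filtered_eqmod_affine x p :
  filtered x p -> poly_eqmod x p ((p`_0)%:P + p`_1 *: 'X).
Proof.
move=> Fp; have /choice[b bE] : forall i, exists b, p`_i.+2 = x * b.
  by move=> i; have [b ->] := Fp i.+2; exists (x ^+ i * b); rewrite mulrA -exprS.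
exists (\poly_(i < size p) (if i is j.+2 then b j else 0)).
apply/polyP=> i; rewrite !coefD coefC !coefZ coefX coef_poly.
case: i => [|[|i]]; rewrite /= ?mulr1 ?mulr0 ?if_same ?mulr0 ?addr0 ?add0r //.
by case: ltnP => [_|le_i]; [rewrite bE | rewrite nth_default ?mulr0].
Qed.

End PolynomialCongruence.

(** * Commutators of automorphisms modulo powers of [c] *)

Section Congruence.
Variable B : comNzRingType.
Implicit Types (x c : B) (f g : autA1 B).

Lemma autA1_mulE f g : val (f * g)%g = val f \Po val g.
Proof. by []. Qed.

(** Composing on the right with [f^-1] cancels [f], so a left inverse modulo [x] determines [f^-1]
    modulo [x]. *)
Lemma autA1_inv_eqmod x f p :
  poly_eqmod x (p \Po val f) 'X -> poly_eqmod x (val f^-1%g) p.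
Proof.
move=> pf; apply: poly_eqmod_sym.
have := poly_eqmod_comp pf (poly_eqmod_refl x (val f^-1%g)).
by rewrite comp_polyX -comp_polyA -autA1_mulE mulgV comp_polyXr.
Qed.

Lemma commg_autA1E f g :
  val (commg f g) = val (g * f)^-1%g \Po val (f * g)%g.
Proof. by rewrite -autA1_mulE /commg /conjg invgM !mulgA. Qed.

Lemma commg_autA1_eqmod x f g :
  poly_eqmod x (val (f * g)%g) (val (g * f)%g) ->
  poly_eqmod x (val (commg f g)) 'X.
Proof.
move=> fg; rewrite commg_autA1E.
have := poly_eqmod_comp (poly_eqmod_refl x (val (g * f)^-1%g)) fg.
by rewrite -[X in poly_eqmod _ _ X]autA1_mulE mulVg.
Qed.

Definition translation_mod x f := exists b, poly_eqmod x (val f) ('X + b%:P).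

Definition congruence_subgroup x : set (autA1 B) :=
  [set f | poly_eqmod x (val f) 'X]%classic.

Lemma translation_mod_group x : group_closed (mem [set f | translation_mod x f]%classic).
Proof.
split=> [|f g /set_mem[a fa] /set_mem[b gb]]; apply/mem_set.
  by exists 0; rewrite addr0; exact: poly_eqmod_refl.
exists (a - b); have gV : poly_eqmod x (val g^-1%g) ('X - b%:P).
  apply: autA1_inv_eqmod; rewrite comp_polyB comp_polyX comp_polyC.
  rewrite -[X in poly_eqmod _ _ X](addrK b%:P 'X).
  exact: poly_eqmodD gb (poly_eqmod_refl _ _).
have := poly_eqmod_comp fa gV.
by rewrite comp_polyD comp_polyX comp_polyC polyCB -addrA (addrC (- _)).
Qed.

Lemma congruence_subgroup_group x : group_closed (mem (congruence_subgroup x)).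
Proof.
split=> [|f g /set_mem fX /set_mem gX]; apply/mem_set.
  exact: poly_eqmod_refl.
have gV : poly_eqmod x (val g^-1%g) 'X by apply: autA1_inv_eqmod; rewrite comp_polyX.
by have := poly_eqmod_comp fX gV; rewrite comp_polyX.
Qed.

(** Modulo [c], [f * g] and [g * f] are affine with the same slope, so they differ by a constant
    [e]. The inverse of [g * f] is filtered because [c] is nilpotent, so it is affine modulo [c];
    its slope [v] turns the shift by [e] into a shift by [v * e]. *)
Lemma commg_filtered c d f g : c ^+ d = 0 ->
  filtered c (val f) -> filtered c (val g) -> translation_mod c (commg f g).
Proof.
move=> c0 Ff Fg.
have Fgf : filtered c (val (g * f)%g) by exact: filtered_comp.
have /filtered_eqmod_affine : filtered c (val (g * f)^-1%g).
  by apply: (filtered_inv c0 Fgf); rewrite -autA1_mulE mulgV.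
set u := (val (g * f)^-1%g)`_0; set v := (val (g * f)^-1%g)`_1 => Egf.
have Ef := filtered_eqmod_affine Ff.
have Eg := filtered_eqmod_affine Fg.
move: (val f)`_0 (val f)`_1 (val g)`_0 (val g)`_1 Ef Eg => a0 a1 b0 b1 Ef Eg.
(* Constant term of [f * g] minus that of [g * f], for the affine parts. *)
pose e := a0 + a1 * b0 - (b0 + b1 * a0); exists (v * e).
have Efg : poly_eqmod c (val (f * g)%g) (val (g * f)%g + e%:P).
  apply: poly_eqmod_trans (poly_eqmod_comp Ef Eg) _.
  apply: poly_eqmod_trans (poly_eqmodD
    (poly_eqmod_sym (poly_eqmod_comp Eg Ef))
    (poly_eqmod_refl _ e%:P)).
  rewrite !comp_polyD !comp_polyZ !comp_polyX !comp_polyC !scalerDr !scalerA.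
  exists 0; rewrite scaler0 addr0 -!mul_polyC /e polyCB !polyCD !polyCM; ring.
rewrite commg_autA1E.
apply: poly_eqmod_trans (poly_eqmod_comp Egf Efg) _.
have -> : (u%:P + v *: 'X) \Po (val (g * f)%g + e%:P) =
          ((u%:P + v *: 'X) \Po val (g * f)%g) + (v * e)%:P.
  rewrite !comp_polyD !comp_polyZ !comp_polyX !comp_polyC scalerDr addrA.
  by rewrite -[v *: e%:P]mul_polyC polyCM.
apply: poly_eqmodD (poly_eqmod_refl _ _).
have := poly_eqmod_comp Egf (poly_eqmod_refl c (val (g * f)%g)).
by rewrite -[X in poly_eqmod _ X _]autA1_mulE mulVg => /poly_eqmod_sym.
Qed.

Lemma commg_translation_mod x f g :
  translation_mod x f -> translation_mod x g -> congruence_subgroup x (commg f g).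
Proof.
move=> [a fa] [b gb]; apply: commg_autA1_eqmod.
apply: poly_eqmod_trans (poly_eqmod_comp fa gb) _.
apply: poly_eqmod_trans (poly_eqmod_sym (poly_eqmod_comp gb fa)).
rewrite !comp_polyD !comp_polyX !comp_polyC addrAC; exact: poly_eqmod_refl.
Qed.

Lemma commg_congruence_subgroup c k f g :
  congruence_subgroup (c ^+ k.+1) f -> congruence_subgroup (c ^+ k.+1) g ->
  congruence_subgroup (c ^+ k.+2) (commg f g).
Proof.
(* Here [f' * g'] is [g'] plus [c ^+ k.+1] times [h \Po g']. As [g'] is ['X] modulo [c], replacing
   [h \Po g'] by [h] costs only a multiple of [c ^+ k.+2]. *)
have compE f' h g' : val f' = 'X + c ^+ k.+1 *: h ->
    congruence_subgroup (c ^+ k.+1) g' ->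
  poly_eqmod (c ^+ k.+2) (val (f' * g')%g) (val g' + c ^+ k.+1 *: h).
  move=> fE g'X; rewrite autA1_mulE fE comp_polyD comp_polyX comp_polyZ.
  apply: poly_eqmodD; first exact: poly_eqmod_refl.
  rewrite exprSr; apply: poly_eqmod_scale.
  rewrite -[X in poly_eqmod _ _ X]comp_polyXr.
  apply: poly_eqmod_comp; first exact: poly_eqmod_refl.
  by apply: (@poly_eqmod_dvd _ _ (c ^+ k)); rewrite -exprS.
move=> [h fE] [h' gE]; apply: commg_autA1_eqmod.
apply: poly_eqmod_trans (compE _ _ _ fE _) _; first by exists h'.
apply: poly_eqmod_trans (poly_eqmod_sym (compE _ _ _ gE _)); last by exists h.
by rewrite fE gE addrAC; exact: poly_eqmod_refl.
Qed.

End Congruence.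

Unset Implicit Arguments.
Set Strict Implicit.

Theorem theorem4p3 (R : comNzRingType) (q : R)
  (q_torsion_free : torsion_free q)
  (q_prime : prime_ideal (principal q)) :
  forall (d : nat) (d_gt0 : (1 <= d)%N),
    solvable_subgroup (Ad (principal_exp_idealr_closed q_prime d_gt0)).
Proof.
move=> d d_gt0; set qdI := principal_exp_idealr_closed _ _.
pose c := quot_proj qdI q; have c0 : c ^+ d = 0 := quot_proj_nilp qdI.
(* The chain starts with filtered, then translation modulo [c]; only from index 2 on do powers of
   [c] enter, with exponent one less than the index. *)
pose N k : set (autA1 (quot_ring qdI)) := match k with
  | 0%N => [set f | filtered c (val f)]%classic
  | 1%N => [set f | translation_mod c f]%classic
  | k.+2 => congruence_subgroup (c ^+ k.+1)
  end.
apply: (@solvable_of_series _ _ N d.-1.+2) => [f /Ad_predP //|[|k]|[|[|k]] f g|f].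
- exact: translation_mod_group.
- exact: congruence_subgroup_group.
- exact: commg_filtered c0.
- by rewrite /N /= expr1; exact: commg_translation_mod.
- exact: commg_congruence_subgroup.
rewrite /N prednK // => -[h fE].
by apply: val_inj; rewrite fE c0 scale0r addr0.
Qed.
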